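(* Let $d\ge1$, $\theta^*\in\mathbb{R}^d$, $\Sigma_x\in\mathbb{R}^{d\times d}$ positive definite, $\sigma_\epsilon>0$. Let $x\sim\mathcal{N}(0,\Sigma_x)$ and $y=\theta^{*\top}x+\epsilon$, where $\epsilon$ is independent of $x$ with $\mathbb{E}[\epsilon]=0$ and $\mathbb{E}[\epsilon^2]=\sigma_\epsilon^2$. For the squared loss $\ell(\theta;(x,y))=\frac12(y-\theta^\top x)^2$, let $\mu_g(\theta)$ and $\Sigma_g(\theta)$ be the mean and covariance of $\nabla_\theta\ell(\theta;(x,y))$. Let $(x^*,y^* )\in\mathbb{R}^d\times\mathbb{R}$ be a target point with residual $\epsilon^*=y^*-\theta^{*\top}x^*$, let $\delta_g=\nabla_\theta\ell(\theta^*;(x^*,y^* ))-\mu_g(\theta^* )$ and $m^*=\delta_g^\top\Sigma_g(\theta^* )^{-1}\delta_g$. Then \[ m^*=\frac{(\epsilon^* )^2}{\sigma_\epsilon^2}\,(x^* )^\top\Sigma_x^{-1}x^*. \] *)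

(* Defs.v *)
From HB Require Import structures.
From mathcomp Require Import all_boot all_order all_algebra.
From mathcomp Require Import all_classical all_reals all_analysis.
Set Implicit Arguments. Unset Strict Implicit. Unset Printing Implicit Defensive.
Import Order.TTheory GRing.Theory Num.Theory.
Import numFieldNormedType.Exports.
Local Open Scope classical_set_scope.
Local Open Scope ring_scope.

Section Defs.
Context {R : realType}.

Definition posdef {n : nat} (S : 'M[R]_n) : Prop :=
  S^T = S /\ forall v : 'cV[R]_n, v != 0 -> 0 < (v^T *m S *m v) 0 0.

Definition sqloss {n : nat} (theta x : 'cV[R]_n) (y : R) : R :=
  2^-1 * (y - (theta^T *m x) 0 0) ^+ 2.

Definition grad {n : nat} (f : 'cV[R]_n -> R) (theta : 'cV[R]_n) : 'cV[R]_n :=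
  \col_i ('D_1 (fun t : R => f (theta + t *: delta_mx i 0)) 0 : R).

Context {d : measure_display} {T : measurableType d} (P : probability T R).

Definition Ex (f : T -> R) : R := fine (\int[P]_w (f w)%:E)%E.

Definition meanv {n : nat} (G : T -> 'cV[R]_n) : 'cV[R]_n :=
  \col_i Ex (fun w => G w i 0).

Definition covm {n : nat} (G : T -> 'cV[R]_n) : 'M[R]_n :=
  \matrix_(i, j) Ex (fun w => (G w i 0 - meanv G i 0) * (G w j 0 - meanv G j 0)).

(* X ~ N(0, S): every nonzero linear functional a^T X is N(0, a^T S a)
   (Cramer-Wold characterisation; normal_prob m s takes the std. deviation s) *)
Definition centered_gaussian {n : nat} (X : T -> 'cV[R]_n) (S : 'M[R]_n) : Prop :=
  (forall i, measurable_fun setT (fun w => X w i 0)) /\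
  forall a : 'cV[R]_n, a != 0 -> forall A : set R, measurable A ->
    P [set w | (a^T *m X w) 0 0 \in A] =
    normal_prob 0 (Num.sqrt ((a^T *m S *m a) 0 0)) A.

Definition indep_vec_rv {n : nat} (X : T -> 'cV[R]_n) (e : T -> R) : Prop :=
  forall (A : 'I_n -> set R) (B : set R),
    (forall i, measurable (A i)) -> measurable B ->
    P ([set w | forall i, X w i ord0 \in A i] `&` (e @^-1` B)) =
    (P [set w | forall i, X w i ord0 \in A i] * P (e @^-1` B))%E.

End Defs.

(* Main.v *)
Require Import Defs.
From HB Require Import structures.
From mathcomp Require Import all_boot all_order all_algebra.
From mathcomp Require Import all_classical all_reals all_analysis.
From mathcomp Require Import measurable_realfun ring lra.
Import Order.TTheory GRing.Theory Num.Theory.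
Import numFieldNormedType.Exports.
Local Open Scope classical_set_scope.
Local Open Scope ring_scope.

(** At the true parameter the gradient of the loss is [- eps * x].  Since [eps]
    is centered and independent of [x], it has mean [0] and covariance
    [E[eps^2] * E[x x^T] = sig^2 * Sx], so the Mahalanobis norm of the target
    gradient [- eps_s * xs] is [eps_s^2 / sig^2 * xs^T Sx^-1 xs].

    The moments [E[(a^T x) (b^T x)] = a^T Sx b] follow by polarization from the
    variances of the one-dimensional marginals; the variance of a normal law is
    an integration by parts based on [p'(x) = - (x - m) / s^2 * p(x)]. *)

(** * Linear algebra and the gradient of the squared loss *)

Local Notation dotv a x := ((a^T *m x) 0 0).
Local Notation bilin S a b := ((a^T *m S *m b) 0 0).

Lemma dotv_delta {R : pzRingType} {n : nat} (x : 'cV[R]_n) i :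
  dotv (delta_mx i (0 : 'I_1)) x = x i 0.
Proof. by rewrite trmx_delta -rowE mxE. Qed.

Lemma bilin_delta {R : pzRingType} {n : nat} (S : 'M[R]_n) i j :
  bilin S (delta_mx i (0 : 'I_1)) (delta_mx j (0 : 'I_1)) = S i j.
Proof. by rewrite trmx_delta -rowE -colE !mxE. Qed.

Lemma dotvDl {R : pzRingType} {n : nat} (a b x : 'cV[R]_n) :
  dotv (a + b) x = dotv a x + dotv b x.
Proof. by rewrite linearD/= mulmxDl mxE. Qed.

Lemma dotvZl {R : pzRingType} {n : nat} (c : R) (a x : 'cV[R]_n) :
  dotv (c *: a) x = c * dotv a x.
Proof. by rewrite linearZ/= -scalemxAl mxE. Qed.

Lemma bilin_polarization {R : comPzRingType} {n : nat} (S : 'M[R]_n)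
    (a b : 'cV[R]_n) : S^T = S ->
  bilin S (a + b) (a + b) = bilin S a a + 2 * bilin S a b + bilin S b b.
Proof.
move=> symS; have symE : bilin S b a = bilin S a b.
  have <- : (a^T *m S *m b)^T = b^T *m S *m a.
    by rewrite !trmx_mul trmxK symS mulmxA.
  by rewrite mxE.
have addE (A B : 'M[R]_1) : (A + B) 0 0 = A 0 0 + B 0 0 by rewrite mxE.
by rewrite [(a + b)^T]linearD/= !mulmxDl !mulmxDr !addE symE; ring.
Qed.

Lemma bilin_invmxZ {R : comUnitRingType} {n : nat} (c s : R) (S : 'M[R]_n)
    (x : 'cV[R]_n) : s \is a GRing.unit -> S \in unitmx ->
  bilin (invmx (s *: S)) (c *: x) (c *: x) = c ^+ 2 / s * bilin (invmx S) x x.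
Proof.
move=> s_unit S_unit; rewrite invmxZ ?unitmxZ// [(c *: x)^T]linearZ/=.
rewrite !(=^~ scalemxAl, =^~ scalemxAr) !scalerA mxE.
by congr (_ * _); ring.
Qed.

Lemma posdef_unitmx {R : realType} {n : nat} (S : 'M[R]_n) :
  posdef S -> S \in unitmx.
Proof.
move=> [_ S_gt0]; rewrite -row_free_unit; apply: inj_row_free => v vS0.
apply/eqP/contraT => v_neq0; have := S_gt0 v^T.
by rewrite trmxK vS0 mul0mx mxE ltxx trmx_eq0 => /(_ v_neq0).
Qed.

Lemma grad_sqloss {R : realType} {n : nat} (theta x : 'cV[R]_n) (y : R) :
  grad (fun th => sqloss th x y) theta = - (y - dotv theta x) *: x.
Proof.
apply/colP => i; rewrite [LHS]mxE [RHS]mxE; set r := y - dotv theta x.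
have -> : (fun t : R => sqloss (theta + t *: delta_mx i 0) x y) =
    cst 2^-1 * (cst r - id * cst (x i 0)) ^+ 2.
  apply/funext => t; rewrite /sqloss dotvDl dotvZl dotv_delta.
  by rewrite opprD addrA.
suff loss' : is_derive (0 : R) (1 : R)
    (cst 2^-1 * (cst r - id * cst (x i 0)) ^+ 2) (- r * x i 0).
  by rewrite derive_val.
apply: is_derive_eq.
by rewrite !fctE /GRing.scale/= !mul0r subr0 /cst; field.
Qed.

(** * Variance of a normal law *)

Lemma ge0_integral_density {d : measure_display} {T : measurableType d}
    {R : realType} (nu : {finite_measure set T -> \bar R})
    (mu : {sigma_finite_measure set T -> \bar R}) (f g : T -> \bar R) :
  mu.-integrable setT g ->
  (forall A, measurable A -> nu A = (\int[mu]_(x in A) g x)%E) ->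
  measurable_fun setT f -> (forall x, 0 <= f x)%E ->
  (\int[nu]_x f x = \int[mu]_x (f x * g x))%E.
Proof.
move=> g_int nuE mf f_ge0; have mg := measurable_int _ g_int.
have dom : nu `<< mu.
  apply/null_content_dominatesP => A mA muA0; rewrite nuE//.
  by apply: null_set_integral => //; exact: measurable_funTS.
have RN_int := Radon_Nikodym_SigmaFinite.f_integrable dom.
rewrite -(Radon_Nikodym_SigmaFinite.change_of_variables dom)//.
apply: ae_eq_integral => //.
- by apply: emeasurable_funM => //; exact: measurable_int RN_int.
- exact: emeasurable_funM.
- apply: ae_eqe_mul2l; apply: integral_ae_eq => // A _ mA.
  by rewrite -Radon_Nikodym_SigmaFinite.f_integral// nuE.
Qed.

Local Notation centered_itv m t := `[(m - t)%R, (m + t)%R]%classic.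

Section lebesgue_integral.
Context {R : realType}.
Notation mu := (@lebesgue_measure R).

Lemma is_derive_integration_by_parts {F G f g : R -> R} {a b : R} :
  a < b -> continuous f -> continuous g ->
  (forall x, is_derive x (1 : R) F (f x)) ->
  (forall x, is_derive x (1 : R) G (g x)) ->
  (\int[mu]_(x in `[a, b]) (F x * g x)%:E =
   (F b * G b - F a * G a)%:E - \int[mu]_(x in `[a, b]) (f x * G x)%:E)%E.
Proof.
move=> ab cf cg F' G'.
have derivable_LR (H h : R -> R) : (forall x, is_derive x (1 : R) H (h x)) ->
    derivable_oo_LRcontinuous H a b.
  move=> H'; have cH : continuous H.
    by move=> x; apply/differentiable_continuous/derivable1_diffP; case: (H' x).
  split; first by move=> x _; case: (H' x).
    exact/cvg_at_right_filter/cH.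
  exact/cvg_at_left_filter/cH.
have derive1_eq (H h : R -> R) : (forall x, is_derive x (1 : R) H (h x)) ->
    {in `]a, b[, H^`()%classic =1 h}.
  by move=> H' x _; rewrite derive1E; case: (H' x).
apply: integration_by_parts => //.
- exact: continuous_subspaceT.
- exact: derivable_LR F'.
- exact: derive1_eq.
- exact: continuous_subspaceT.
- exact: derivable_LR G'.
- exact: derive1_eq.
Qed.

Lemma ge0_cvg_integral_centered_itv {f : R -> R} (m : R) :
  measurable_fun setT f -> (forall x, 0 <= f x) ->
  (\int[mu]_(x in centered_itv m n%:R) (f x)%:E @[n --> \oo] -->
   \int[mu]_x (f x)%:E)%E.
Proof.
move=> mf f0.
have <- : \bigcup_n centered_itv m n%:R = setT.
  rewrite -subTset => x _; exists (Num.bound `|x - m|) => //.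
  by rewrite /= in_itv/= -ler_distl ltW// archi_boundP.
apply: ge0_nondecreasing_set_cvg_integral => //.
- move=> n k nk; apply/subsetPset; apply: subset_itvScc.
    by rewrite bnd_simp lerD2l lerN2 ler_nat.
  by rewrite bnd_simp lerD2l ler_nat.
- by move=> n; apply/measurable_EFinP; exact: measurable_funTS.
- by move=> n x _; rewrite lee_fin.
Qed.

End lebesgue_integral.

Section normal_variance.
Context {R : realType}.
Notation mu := (@lebesgue_measure R).
Implicit Types m s t x : R.

Lemma is_derive_normal_pdf m s x : s != 0 ->
  is_derive x (1 : R) (normal_pdf m s) (- (x - m) / s ^+ 2 * normal_pdf m s x).
Proof.
move=> s0; rewrite normal_pdfE//.
have -> : (fun x => normal_peak s * normal_fun m s x) =
    cst (normal_peak s) *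
    (expR \o (- ((id - cst m) ^+ 2) * cst (s ^+ 2 *+ 2)^-1)) by [].
by apply: is_derive_eq; rewrite !fctE /GRing.scale/= /cst /normal_fun; field.
Qed.

Lemma normal_pdf_sym m s t : s != 0 ->
  normal_pdf m s (m - t) = normal_pdf m s (m + t).
Proof.
move=> s0; rewrite !normal_pdfE// /normal_fun.
by rewrite [m - t - m]addrAC [m + t - m]addrAC subrr !add0r sqrrN.
Qed.

Lemma sqr_normal_pdf_le m s x : s != 0 ->
  (x - m) ^+ 2 * normal_pdf m s x <= normal_peak s * (s ^+ 2 *+ 2).
Proof.
move=> s0; have q0 : 0 < s ^+ 2 *+ 2 by rewrite mulrn_wgt0// exprn_even_gt0.
rewrite normal_pdfE// /normal_fun mulrCA ler_wpM2l ?normal_peak_ge0//.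
rewrite mulNr expRN ler_pdivrMr ?expR_gt0// -ler_pdivrMl// mulrC.
by rewrite (le_trans _ (expR_ge1Dx _))// lerDr.
Qed.

Lemma cvg_mul_normal_pdf m s : s != 0 ->
  t * normal_pdf m s (m + t) @[t --> +oo] --> (0 : R).
Proof.
move=> s0; set K := normal_peak s * (s ^+ 2 *+ 2).
apply: (@squeeze_cvgr _ _ _ _ (cst 0) (fun t => K / t)).
- near=> t.
  have t0 : 0 < t by near: t; exact: nbhs_pinfty_gt.
  rewrite /= mulr_ge0 ?normal_pdf_ge0 ?(ltW t0)//= ler_pdivlMr// mulrAC -expr2.
  by have := sqr_normal_pdf_le m s (m + t) s0; rewrite addrAC subrr add0r.
- exact: cvg_cst.
- rewrite -[X in _ --> X](mulr0 K); apply: cvgM; first exact: cvg_cst.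
  by apply/gtr0_cvgV0; [exact: nbhs_pinfty_gt|exact: cvg_id].
Unshelve. all: by end_near. Qed.

Lemma integral_sqr_normal_pdf_itv m s t : s != 0 -> 0 < t ->
  (\int[mu]_(x in centered_itv m t) ((x - m) ^+ 2 * normal_pdf m s x)%:E =
   (- (2 * s ^+ 2) * (t * normal_pdf m s (m + t)))%:E +
   (s ^+ 2)%:E * \int[mu]_(x in centered_itv m t) (normal_pdf m s x)%:E)%E.
Proof.
move=> s0 t0; set p := normal_pdf m s.
have cp : continuous p by exact: continuous_normal_pdf.
pose F x := - s ^+ 2 * (x - m).
have F' x : is_derive x (1 : R) F (- s ^+ 2).
  have -> : F = cst (- s ^+ 2) * (id - cst m) by [].
  by apply: is_derive_eq; rewrite !fctE /GRing.scale/= /cst; ring.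
have p' x : is_derive x (1 : R) p (- (x - m) / s ^+ 2 * p x).
  exact: is_derive_normal_pdf.
have p'_continuous : continuous (fun x => - (x - m) / s ^+ 2 * p x).
  move=> x; apply: cvgM; last exact: cp.
  by apply: cvgMl; apply: cvgN; apply: cvgB; [exact: cvg_id|exact: cvg_cst].
transitivity (\int[mu]_(x in centered_itv m t)
    (F x * (- (x - m) / s ^+ 2 * p x))%:E)%E.
  by apply: eq_integral => x _; congr EFin; rewrite /F; field.
have mt : m - t < m + t by rewrite ltrD2l gtrN.
rewrite (is_derive_integration_by_parts mt (fun=> cvg_cst _) _ F' p')//.
under eq_integral do rewrite EFinM.
rewrite integralZl//; last first.
  by apply: (integrableS measurableT) => //; exact: integrable_normal_pdf.
rewrite EFinN mulNe oppeK; congr (_%:E + _)%E.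
by rewrite /p normal_pdf_sym// /F; ring.
Qed.

(* At [s = 0] the library's [normal_prob m s] is the uniform law on the unit
   interval, not a Dirac mass. *)
Lemma normal_prob_variance m s : s != 0 ->
  (\int[normal_prob m s]_x ((x - m) ^+ 2)%:E = (s ^+ 2)%:E)%E.
Proof.
move=> s0; pose p := normal_pdf m s.
have p_ge0 x : 0 <= p x by exact: normal_pdf_ge0.
have mp : measurable_fun setT p by exact: measurable_normal_pdf.
have msq : measurable_fun setT (fun x : R => (x - m) ^+ 2).
  by apply: measurable_funX; exact: measurable_funB.
rewrite (@ge0_integral_density _ _ _ _ mu _ (EFin \o p))//; last 3 first.
- exact: integrable_normal_pdf.
- exact/measurable_EFinP.
- by move=> x; rewrite lee_fin sqr_ge0.
under eq_integral do rewrite -EFinM.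
have cvg_var := ge0_cvg_integral_centered_itv m (measurable_funM msq mp)
  (fun x => mulr_ge0 (sqr_ge0 _) (p_ge0 x)).
apply: (cvg_unique _ cvg_var) => //.
have cvg_boundary : (- (2 * s ^+ 2) * (n%:R * p (m + n%:R)))%:E
    @[n --> \oo] --> (0 : \bar R).
  apply: cvg_EFin; first by near=> n.
  rewrite -[X in _ --> X](mulr0 (- (2 * s ^+ 2))).
  apply: cvgM; first exact: cvg_cst.
  exact: (cvg_comp _ _ (@cvgr_idn R) (cvg_mul_normal_pdf _ _ _)).
have cvg_mass := ge0_cvg_integral_centered_itv m mp p_ge0.
rewrite integral_normal_pdf in cvg_mass.
have sqr_s_fin : (s ^+ 2)%:E \is a fin_num by [].
have := cvgeD _ cvg_boundary (cvgeZl sqr_s_fin cvg_mass).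
rewrite add0e mule1 => /(_ _ isT); apply: cvg_trans.
apply: near_eq_cvg; near=> n.
rewrite integral_sqr_normal_pdf_itv// ltr0n; near: n; exact: nbhs_infty_gt.
Unshelve. all: by end_near. Qed.

End normal_variance.

Lemma normally_distributed_variance {d : measure_display} {T : measurableType d}
    {R : realType} (P : probability T R) (Y : T -> R) (m s : R) : s != 0 ->
  measurable_fun setT Y ->
  (forall A, measurable A -> P (Y @^-1` A) = normal_prob m s A) ->
  ('E_P[fun w => ((Y w - m) ^+ 2)%R] = (s ^+ 2)%:E)%E.
Proof.
move=> s0 mY PY.
have mYR : measurable_fun setT (Y : T -> measurableTypeR R) := mY.
pose rvY : {RV P >-> measurableTypeR R} :=
  @mfun_Sub _ _ _ (measurableTypeR R) _ (mem_set mYR).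
transitivity (\int[distribution P rvY]_x ((x - m) ^+ 2)%:E)%E.
  rewrite unlock ge0_integral_distribution//; last first.
    by move=> x; rewrite lee_fin sqr_ge0.
  by apply/measurable_EFinP/measurable_funX; exact: measurable_funB.
rewrite (eq_measure_integral (normal_prob m s)).
  exact: normal_prob_variance.
by move=> A mA _; exact: PY.
Qed.

(** * Independence *)

Lemma measurable_preimageT {d1 d2 : measure_display} {T1 : measurableType d1}
    {T2 : measurableType d2} (f : T1 -> T2) (A : set T2) :
  measurable_fun setT f -> measurable A -> measurable (f @^-1` A).
Proof. by move=> mf mA; rewrite -[f @^-1` A]setTI; exact: mf. Qed.

Definition independent_rv {R : realType} {d d1 d2 : measure_display}
    {T : measurableType d} {T1 : measurableType d1} {T2 : measurableType d2}
    (P : probability T R) (U : T -> T1) (V : T -> T2) : Prop :=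
  forall A B, measurable A -> measurable B ->
    P (U @^-1` A `&` V @^-1` B) = (P (U @^-1` A) * P (V @^-1` B))%E.

Section independence.
Context {R : realType} {d d1 d2 : measure_display} {T : measurableType d}
  {T1 : measurableType d1} {T2 : measurableType d2} {P : probability T R}.
Local Open Scope ereal_scope.

Lemma independent_rv_comp {d3 d4 : measure_display} {T3 : measurableType d3}
    {T4 : measurableType d4} {U : T -> T1} {V : T -> T2}
    {f : T1 -> T3} {g : T2 -> T4} :
  measurable_fun setT f -> measurable_fun setT g ->
  independent_rv P U V -> independent_rv P (f \o U) (g \o V).
Proof.
move=> mf mg UV A B mA mB.
by apply: (UV (f @^-1` A) (g @^-1` B)); exact: measurable_preimageT.
Qed.

Lemma independent_rv_setI_closed (G : set (set T1))
    {U : T -> T1} {V : T -> T2} :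
  measurable_fun setT U -> measurable_fun setT V ->
  measurable = <<s G >> -> setI_closed G ->
  (forall A B, G A -> measurable B ->
    P (U @^-1` A `&` V @^-1` B) = P (U @^-1` A) * P (V @^-1` B)) ->
  independent_rv P U V.
Proof.
move=> mU mV mG GI UV A B mA mB.
have mUE S : measurable S -> measurable (U @^-1` S).
  exact: measurable_preimageT.
have mVB : measurable (V @^-1` B) by exact: measurable_preimageT.
pose indepB S := P (U @^-1` S `&` V @^-1` B) = P (U @^-1` S) * P (V @^-1` B).
have sGA : <<s G >> A by rewrite -mG.
apply: (dynkin_induction (P := indepB) mG GI) sGA; rewrite /indepB.
- by rewrite preimage_setT setTI probability_setT mul1e.
- by move=> S GS; exact: UV.
- move=> S mS SV; rewrite preimage_setC setIC -setDE.
  have -> : P (V @^-1` B `\` U @^-1` S) =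
      P (V @^-1` B) - P (U @^-1` S `&` V @^-1` B).
    rewrite setIC; apply: measureD => //; first exact: mUE.
    by rewrite ltey_eq fin_num_measure.
  rewrite SV probability_setC; last exact: mUE.
  by rewrite muleBl ?mul1e ?fin_num_measure//; exact: mUE.
- move=> F mF tF FV; rewrite preimage_bigcup setI_bigcupl.
  have tUF : trivIset setT (fun k => U @^-1` F k).
    by move=> i j _ _ [w [Fi Fj]]; apply: tF => //; exists (U w).
  rewrite !measure_bigcup//; last 3 first.
  + by move=> k _; exact: mUE.
  + by move=> k _; apply: measurableI => //; exact: mUE.
  + exact: trivIset_setIr.
  rewrite muleC -(fineK (fin_num_measure P _ mVB)) -nneseriesZl//.
  apply: eq_eseriesr => k _; rewrite fineK ?fin_num_measure// muleC.
  exact: FV.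
Qed.

Lemma independent_distribution_pair (U : {RV P >-> T1}) (V : {RV P >-> T2}) :
  independent_rv P U V -> forall A, measurable A ->
  P ((fun w => (U w, V w)) @^-1` A) = (distribution P U \x distribution P V) A.
Proof.
move=> UV A mA.
have mW : measurable_fun setT (fun w => (U w, V w)).
  exact: measurable_fun_pair.
pose W : {RV P >-> (T1 * T2)%type} := mfun_Sub (mem_set mW).
by rewrite -[LHS]/(distribution P W A); apply/esym/product_measure_unique.
Qed.

End independence.

Section product_integral.
Context {R : realType} {d1 d2 : measure_display} {T1 : measurableType d1}
  {T2 : measurableType d2} {m1 : {sigma_finite_measure set T1 -> \bar R}}
  {m2 : {sigma_finite_measure set T2 -> \bar R}} {f : T1 -> R} {g : T2 -> R}.
Hypotheses (intf : m1.-integrable setT (EFin \o f))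
  (intg : m2.-integrable setT (EFin \o g)).
Local Open Scope ereal_scope.

Lemma integrable_prod_mul :
  (m1 \x m2).-integrable setT (fun z => (f z.1 * g z.2)%:E).
Proof.
have /integrableP[/measurable_EFinP mf f_lty] := intf.
have /integrableP[/measurable_EFinP mg g_lty] := intg.
apply/integrable12ltyP => /=.
  by apply/measurable_EFinP; apply: measurable_funM; apply: measurableT_comp.
under eq_integral.
  move=> x _; under eq_integral do rewrite normrM EFinM.
  rewrite ge0_integralZl//; last by do 2 apply: measurableT_comp => //.
  over.
rewrite ge0_integralZr//.
- apply: lte_mul_pinfty => //; first exact: integral_ge0.
  by rewrite ge0_fin_numE//; exact: integral_ge0.
- by do 2 apply: measurableT_comp => //.
- exact: integral_ge0.
Qed.

Lemma integral_prod_mul :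
  \int[m1 \x m2]_z (f z.1 * g z.2)%:E =
  \int[m1]_x (f x)%:E * \int[m2]_y (g y)%:E.
Proof.
rewrite -integral12_prod_meas1; last exact: integrable_prod_mul.
rewrite /fubini_F /=.
under eq_integral do rewrite (integralZl measurableT intg).
by rewrite -(fineK (integrable_fin_num measurableT intg)) integralZr.
Qed.

End product_integral.

Section independent_product.
Context {R : realType} {d : measure_display} {T : measurableType d}
  {P : probability T R} {X Y : T -> R}.
Hypotheses (XY : independent_rv P X Y)
  (X_L1 : X \in Lfun P 1) (Y_L1 : Y \in Lfun P 1).

Let rvX : {RV P >-> R} := mfun_Sub (sub_Lfun_mfun X_L1).
Let rvY : {RV P >-> R} := mfun_Sub (sub_Lfun_mfun Y_L1).

Let measurable_pair : measurable_fun setT (fun w => (X w, Y w)).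
Proof.
apply: measurable_fun_pair; first exact: (measurable_funP rvX).
exact: (measurable_funP rvY).
Qed.

Let rvXY : {RV P >-> (R * R)%type} := mfun_Sub (mem_set measurable_pair).

Let distribution_pair A : measurable A ->
  distribution P rvXY A = (distribution P rvX \x distribution P rvY)%E A.
Proof. exact: (independent_distribution_pair rvX rvY XY). Qed.

Let integrable_distribution (Z : {RV P >-> R}) : (Z : T -> R) \in Lfun P 1 ->
  (distribution P Z).-integrable setT (EFin \o id).
Proof.
move=> /Lfun1_integrable Z_L1; apply: integrable_pushforward => //.
exact/measurable_EFinP.
Qed.

Let expectation_distribution (Z : {RV P >-> R}) : (Z : T -> R) \in Lfun P 1 ->
  (\int[distribution P Z]_x x%:E = 'E_P[Z])%E.
Proof.
by move=> /Lfun1_integrable Z_L1; rewrite unlock integral_distribution.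
Qed.

Lemma independent_mul_Lfun1 : X \* Y \in Lfun P 1.
Proof.
have mmul : measurable_fun setT (fun z : R * R => (z.1 * z.2)%:E).
  by apply/measurable_EFinP; exact: measurable_funM.
apply/Lfun1_integrable/integrableP; split.
  exact: (measurableT_comp mmul measurable_pair).
have /integrableP[_] := integrable_prod_mul
  (integrable_distribution rvX X_L1) (integrable_distribution rvY Y_L1).
rewrite (eq_measure_integral (distribution P rvXY)); last first.
  by move=> A mA _; exact/esym/distribution_pair.
by rewrite ge0_integral_distribution//; exact: measurableT_comp.
Qed.

Lemma independent_expectationM : ('E_P[X \* Y] = 'E_P[X] * 'E_P[Y])%E.
Proof.
transitivity (\int[distribution P rvXY]_z (z.1 * z.2)%:E)%E.
  rewrite unlock integral_distribution//.
    by apply/measurable_EFinP; exact: measurable_funM.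
  exact/Lfun1_integrable/independent_mul_Lfun1.
rewrite (eq_measure_integral (distribution P rvX \x distribution P rvY)%E).
  rewrite (integral_prod_mul (integrable_distribution rvX X_L1)
    (integrable_distribution rvY Y_L1)).
  by congr (_ * _)%E; exact: expectation_distribution.
by move=> A mA _; exact: distribution_pair.
Qed.

End independent_product.

Section tuple_boxes.
Context {d : measure_display} {T : measurableType d} {n : nat}.

Definition tuple_box (A : 'I_n -> set T) : set (n.-tuple T) :=
  [set t | forall i, A i (tnth t i)].

Definition tuple_boxes : set (set (n.-tuple T)) :=
  [set tuple_box A | A in [set A | forall i, measurable (A i)]].

Lemma setI_closed_tuple_boxes : setI_closed tuple_boxes.
Proof.
move=> _ _ [A mA <-] [B mB <-]; exists (fun i => A i `&` B i).
  by move=> i; exact: measurableI.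
apply/seteqP; split=> t /=; first by move=> ABt; split=> i; case: (ABt i).
by move=> [At Bt] i; split; [exact: At|exact: Bt].
Qed.

Lemma measurable_tuple_boxesE : measurable = <<s tuple_boxes >>.
Proof.
apply/seteqP; split.
  apply: sub_smallest2r; first exact: smallest_sigma_algebra.
  rewrite -bigcup_seq; apply: bigcup_sub => i _ _ [A mA <-].
  exists (fun j => if j == i then A else setT); first by move=> j /=; case: ifP.
  apply/seteqP; split=> t /=.
    by move=> /(_ i); rewrite eqxx; split.
  by move=> [_ Ati] j; case: eqP => // ->.
apply: smallest_sub; first exact: sigma_algebra_measurable.
move=> _ [A mA <-].
have -> : tuple_box A = \bigcap_(i in [set: 'I_n]) (@tnth n T ^~ i) @^-1` A i.
  by apply/seteqP; split=> t At i; [move=> _|]; exact: At.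
apply: fin_bigcap_measurable => // i _.
by apply: measurable_preimageT => //; exact: measurable_tnth.
Qed.

End tuple_boxes.

Section indep_vec_rv.
Context {R : realType} {d : measure_display} {T : measurableType d}
  {P : probability T R} {n : nat} {X : T -> 'cV[R]_n} {e : T -> R}.
Hypothesis Xe : indep_vec_rv P X e.

Lemma indep_vec_rv_comp (g : R -> R) : measurable_fun setT g ->
  indep_vec_rv P X (g \o e).
Proof.
move=> mg A B mA mB; apply: (Xe A (g @^-1` B)) => //.
exact: measurable_preimageT.
Qed.

Hypotheses (mX : forall i, measurable_fun setT (fun w => X w i 0))
  (me : measurable_fun setT e).

Let coords w : n.-tuple R := [tuple X w i 0 | i < n].

Lemma indep_vec_rv_tuple : independent_rv P coords e.
Proof.
apply: (independent_rv_setI_closed tuple_boxes) => //.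
- apply/measurable_fun_tnthP => i; apply: eq_measurable_fun (mX i) => w _.
  by rewrite /= tnth_mktuple.
- exact: measurable_tuple_boxesE.
- exact: setI_closed_tuple_boxes.
- move=> _ B [A mA <-] mB.
  have -> : coords @^-1` tuple_box A = [set w | forall i, X w i ord0 \in A i].
    by apply/seteqP; split=> w Aw i; have := Aw i; rewrite tnth_mktuple inE.
  exact: Xe.
Qed.

Lemma indep_vec_rv_coord i : independent_rv P (fun w => X w i 0) e.
Proof.
have -> : (fun w => X w i 0) = (@tnth n R ^~ i) \o coords.
  by apply/funext => w; rewrite /= tnth_mktuple.
apply: (independent_rv_comp (g := id)) => //; first exact: measurable_tnth.
exact: indep_vec_rv_tuple.
Qed.

Lemma indep_vec_rv_coordM i j (g : R -> R) : measurable_fun setT g ->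
  independent_rv P (fun w => X w i 0 * X w j 0) (g \o e).
Proof.
move=> mg; have -> : (fun w => X w i 0 * X w j 0) =
    (fun t : n.-tuple R => tnth t i * tnth t j) \o coords.
  by apply/funext => w; rewrite /= !tnth_mktuple.
apply: independent_rv_comp => //; last exact: indep_vec_rv_tuple.
by apply: measurable_funM; exact: measurable_tnth.
Qed.

End indep_vec_rv.

(** * Second moments *)

Lemma integral_sqr_lty_Lfun2 {d : measure_display} {T : measurableType d}
    {R : realType} {mu : {measure set T -> \bar R}} {f : T -> R} :
  measurable_fun setT f ->
  (\int[mu]_x (f x ^+ 2)%:E < +oo)%E -> f \in Lfun mu 2%:E.
Proof.
move=> mf f2_lty; rewrite inE; apply/andP; split; rewrite inE//=.
rewrite /finite_norm unlock /Lnorm poweR_lty//; apply: le_lt_trans f2_lty.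
rewrite le_eqVlt; apply/predU1P; left; apply: eq_integral => x _.
by rewrite /= powR_mulrn// real_normK ?num_real.
Qed.

Lemma expectationN {d : measure_display} {T : measurableType d} {R : realType}
    {P : probability T R} {X : T -> R} : X \in Lfun P 1 ->
  ('E_P[\- X] = - 'E_P[X])%E.
Proof.
by move=> /Lfun1_integrable X_L1; rewrite unlock -integralN ?integrable_add_def.
Qed.

Lemma expectation_sqrD {d : measure_display} {T : measurableType d}
    {R : realType} {P : probability T R} {X Y : T -> R} :
  X \in Lfun P 2%:E -> Y \in Lfun P 2%:E ->
  ('E_P[fun w => ((X w + Y w) ^+ 2)%R] =
   'E_P[fun w => (X w ^+ 2)%R] + 2%:E * 'E_P[X \* Y] +
   'E_P[fun w => (Y w ^+ 2)%R])%E.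
Proof.
move=> X_L2 Y_L2; have XY_L1 := Lfun2_mul_Lfun1 X_L2 Y_L2.
have sqr_L1 (Z : T -> R) : Z \in Lfun P 2%:E ->
    (fun w => Z w ^+ 2) \in Lfun P 1.
  by move=> Z_L2; exact: Lfun2_mul_Lfun1.
have -> : (fun w => (X w + Y w) ^+ 2) =
    ((fun w => X w ^+ 2) \+ (2 \o* (X \* Y))) \+ (fun w => Y w ^+ 2).
  by apply/funext => w; rewrite /= sqrrD mulr_natr.
have XY2_L1 : 2 \o* (X \* Y) \in Lfun P 1 by exact: Lfun_scale.
rewrite !expectationD ?expectationZl ?sqr_L1//.
by apply: rpredD => //; exact: sqr_L1.
Qed.

Definition second_momentm {R : realType} {d : measure_display}
    {T : measurableType d} (P : probability T R) {n : nat}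
    (X : T -> 'cV[R]_n) : 'M[R]_n :=
  \matrix_(i, j) Ex P (fun w => X w i 0 * X w j 0).

Lemma ExE {R : realType} {d : measure_display} {T : measurableType d}
  (P : probability T R) (f : T -> R) : Ex P f = fine 'E_P[f].
Proof. by rewrite /Ex unlock. Qed.

Section gaussian_moments.
Context {R : realType} {d : measure_display} {T : measurableType d}
  {P : probability T R} {n : nat} {X : T -> 'cV[R]_n} {S : 'M[R]_n}.
Hypotheses (Spd : posdef S) (XS : centered_gaussian P X S).

Let marginal (a : 'cV[R]_n) : T -> R := fun w => dotv a (X w).

Let measurable_marginal a : measurable_fun setT (marginal a).
Proof.
rewrite /marginal; under eq_fun do rewrite mxE.
by apply: measurable_sum => j; apply: measurable_funM => //; exact: XS.1.
Qed.

Lemma gaussian_expectation_sqr (a : 'cV[R]_n) :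
  ('E_P[fun w => (marginal a w ^+ 2)%R] = (bilin S a a)%:E)%E.
Proof.
have [->|a0] := eqVneq a 0.
  rewrite mulmx0 mxE unlock; apply: integral0_eq => w _.
  by rewrite /marginal trmx0 mul0mx mxE expr0n.
have aSa_gt0 := Spd.2 a a0.
have := normally_distributed_variance P (marginal a) 0
  (Num.sqrt (bilin S a a)).
under eq_fun do rewrite subr0.
rewrite sqr_sqrtr; last exact: ltW.
apply=> //; first by rewrite gt_eqF// sqrtr_gt0.
move=> A mA; rewrite -(XS.2 a a0 A mA); congr (P _).
by apply/seteqP; split => w /=; rewrite inE.
Qed.

Lemma gaussian_Lfun2 (a : 'cV[R]_n) : marginal a \in Lfun P 2%:E.
Proof.
apply: integral_sqr_lty_Lfun2 => //.
by have := gaussian_expectation_sqr a; rewrite unlock => ->; rewrite ltry.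
Qed.

Lemma gaussian_expectation_mul (a b : 'cV[R]_n) :
  ('E_P[marginal a \* marginal b] = (bilin S a b)%:E)%E.
Proof.
have a_L2 := gaussian_Lfun2 a; have b_L2 := gaussian_Lfun2 b.
have := expectation_sqrD a_L2 b_L2.
have -> : (fun w => (marginal a w + marginal b w) ^+ 2) =
    (fun w => marginal (a + b) w ^+ 2).
  by apply/funext => w; rewrite /marginal dotvDl.
rewrite !gaussian_expectation_sqr bilin_polarization; last exact: Spd.1.
have /fineK <- := expectation_fin_num (Lfun2_mul_Lfun1 a_L2 b_L2).
rewrite -EFinM -!EFinD => -[polar]; congr EFin; lra.
Qed.

Let marginal_delta i : marginal (delta_mx i 0) = fun w => X w i 0.
Proof. by apply/funext => w; exact: dotv_delta. Qed.

Lemma gaussian_coord_Lfun2 i : (fun w => X w i 0) \in Lfun P 2%:E.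
Proof. by rewrite -marginal_delta; exact: gaussian_Lfun2. Qed.

Lemma gaussian_second_momentm : second_momentm P X = S.
Proof.
apply/matrixP => i j; rewrite mxE ExE.
have := gaussian_expectation_mul (delta_mx i 0) (delta_mx j 0).
by rewrite !marginal_delta bilin_delta => ->.
Qed.

End gaussian_moments.

Section independent_scaling.
Context {R : realType} {d : measure_display} {T : measurableType d}
  {P : probability T R} {n : nat} {X : T -> 'cV[R]_n} {e : T -> R}.
Hypotheses (X_L2 : forall i, (fun w => X w i 0) \in Lfun P 2%:E)
  (e_L2 : e \in Lfun P 2%:E) (Xe : indep_vec_rv P X e).

Let measurable_coord i : measurable_fun setT (fun w => X w i 0).
Proof. by have /sub_Lfun_mfun/set_mem := X_L2 i. Qed.

Let measurable_e : measurable_fun setT e.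
Proof. by have /sub_Lfun_mfun/set_mem := e_L2. Qed.

Let Lfun2_Lfun1 (f : T -> R) : f \in Lfun P 2%:E -> f \in Lfun P 1.
Proof. by apply: Lfun_subset12; exact: fin_num_measure. Qed.

Lemma meanv_scale_independent :
  meanv P (fun w => e w *: X w) = Ex P e *: meanv P X.
Proof.
apply/colP => i; rewrite !mxE !ExE mulrC.
rewrite -fineM ?expectation_fin_num ?Lfun2_Lfun1//.
rewrite -independent_expectationM ?Lfun2_Lfun1//; last exact: indep_vec_rv_coord.
by congr (fine 'E_P[_]); apply/funext => w; rewrite mxE mulrC.
Qed.

Lemma second_momentm_scale_independent :
  second_momentm P (fun w => e w *: X w) =
  Ex P (fun w => e w ^+ 2) *: second_momentm P X.
Proof.
have sqr_e_L1 : (fun w => e w ^+ 2) \in Lfun P 1.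
  exact: (Lfun2_mul_Lfun1 e_L2 e_L2).
apply/matrixP => i j; rewrite !mxE !ExE mulrC.
have XX_L1 := Lfun2_mul_Lfun1 (X_L2 i) (X_L2 j).
rewrite -fineM ?expectation_fin_num// -independent_expectationM//.
  by congr (fine 'E_P[_]); apply/funext => w; rewrite !mxE/=; ring.
exact: (indep_vec_rv_coordM _ _ _ i j (fun u => u ^+ 2)).
Qed.

End independent_scaling.

Lemma covm_centered {R : realType} {d : measure_display} {T : measurableType d}
    {P : probability T R} {n : nat} {G : T -> 'cV[R]_n} :
  meanv P G = 0 -> covm P G = second_momentm P G.
Proof.
move=> G0; apply/matrixP => i j; rewrite [LHS]mxE [RHS]mxE G0; congr (Ex P _).
by apply/funext => w; rewrite !mxE !subr0.
Qed.

Theorem theoremF10 (R : realType) (dsp : measure_display) (T : measurableType dsp)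
  (P : probability T R) (n : nat) (hn : (0 < n)%N)
  (theta_star : 'cV[R]_n) (Sx : 'M[R]_n) (sig : R)
  (X : T -> 'cV[R]_n) (eps : T -> R)
  (xs : 'cV[R]_n) (ys : R) :
  posdef Sx -> 0 < sig ->
  centered_gaussian P X Sx ->
  measurable_fun setT eps ->
  indep_vec_rv P X eps ->
  P.-integrable setT (fun w => (eps w)%:E) ->
  (\int[P]_w (eps w)%:E = 0)%E ->
  (\int[P]_w ((eps w) ^+ 2)%:E = (sig ^+ 2)%:E)%E ->
  let y := fun w => (theta_star^T *m X w) 0 0 + eps w in
  let G := fun theta : 'cV[R]_n => fun w =>
             grad (fun th => sqloss th (X w) (y w)) theta in
  let mu_g := fun theta => meanv P (G theta) in
  let Sigma_g := fun theta => covm P (G theta) in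
  let eps_s := ys - (theta_star^T *m xs) 0 0 in
  let delta_g := grad (fun th => sqloss th xs ys) theta_star - mu_g theta_star in
  let m_star := (delta_g^T *m invmx (Sigma_g theta_star) *m delta_g) 0 0 in
  m_star = eps_s ^+ 2 / sig ^+ 2 * (xs^T *m invmx Sx *m xs) 0 0.
Proof.
move=> Spd sig_gt0 XS meps Xeps _ Eeps Eeps2 y G mu_g Sigma_g eps_s delta_g.
move=> m_star.
have X_L2 := gaussian_coord_Lfun2 Spd XS.
have eps_L2 : eps \in Lfun P 2%:E.
  by apply: integral_sqr_lty_Lfun2; rewrite // Eeps2 ltry.
have Neps_L2 : \- eps \in Lfun P 2%:E by rewrite -[\- eps]/(- eps) rpredN.
have XNeps : indep_vec_rv P X (\- eps).
  exact: (indep_vec_rv_comp Xeps -%R).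
have GE : G theta_star = fun w => (\- eps) w *: X w.
  by apply/funext => w; rewrite /G grad_sqloss /y addrAC subrr add0r.
have mu0 : mu_g theta_star = 0.
  rewrite /mu_g GE meanv_scale_independent// ExE expectationN; last first.
    exact: (Lfun_subset12 (fin_num_measure P _ measurableT)).
  by rewrite unlock Eeps oppe0 scale0r.
have SigmaE : Sigma_g theta_star = sig ^+ 2 *: Sx.
  rewrite /Sigma_g covm_centered// GE second_momentm_scale_independent//.
  rewrite (gaussian_second_momentm Spd XS); congr (_ *: _).
  by rewrite /Ex; under eq_integral do rewrite /= sqrrN; rewrite Eeps2.
have deltaE : delta_g = - eps_s *: xs by rewrite /delta_g mu0 subr0 grad_sqloss.
rewrite /m_star SigmaE deltaE bilin_invmxZ ?sqrrN ?posdef_unitmx//.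
by rewrite unitfE expf_neq0// gt_eqF.
Qed.
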